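(* Let $H=\bigotimes_{i=1}^NH_i$ be a Hilbert space with $\dim H_i=d_i$ and let $d=d_1\cdots d_N$. Let $|\varphi\rangle$ and $|\psi\rangle$ be two $N$-partite pure states in $H$, with coefficient tensors $\mathcal{X}$ and $\mathcal{X}'$ and mode-$i$ matricizations $X_{(i)}$ and $X'_{(i)}$ respectively. Then $|\varphi\rangle$ is LU equivalent to $|\psi\rangle$ if and only if for $i=1,\dots,N$ there are unitary matrices $U_i\in SU(d_i)$ and $Q_i\in SU(d/d_i)$ such that $$X'_{(i)}=U_iX_{(i)}Q_i^{\mathrm t}$$ and $$\operatorname{rank}\bigl(R\bigl((Q_i)_{j|\widehat j}\bigr)\bigr)=1\qquad\text{for all } j\in\{1,\dots,N\},\ j\neq i.$$
   Context: Each $H_t$ is a complex Hilbert space of finite dimension $d_t$ with a fixed orthonormal basis $|1\rangle,\dots,|d_t\rangle$. A pure state is a unit vector $\sum_{j_1,\dots,j_N}\alpha_{j_1\cdots j_N}|j_1\cdots j_N\rangle$ of $H$, and its coefficient tensor is the array $(\alpha_{j_1\cdots j_N})\in\mathbb{C}^{d_1\times\cdots\times d_N}$. Two pure states $|\varphi\rangle,|\psi\rangle$ are LU (local unitary) equivalent if $|\varphi\rangle=(V_1\otimes\cdots\otimes V_N)|\psi\rangle$ for some unitary operators $V_i$ on $H_i$. $SU(n)$ denotes the group of $n\times n$ unitary matrices of determinant one. The mode-$n$ matricization $X_{(n)}$ of a tensor $\mathcal{X}=(x_{i_1\cdots i_N})$ of size $d_1\times\cdots\times d_N$ is the $d_n\times\prod_{m\ne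 n}d_m$ matrix whose $(i_n,j)$ entry is $x_{i_1\cdots i_N}$, where $j=1+\sum_{k\neq n}(i_k-1)\beta_k$ and $\beta_k=\prod_{m<k,\ m\neq n}d_m$. $\mathrm t$ denotes transpose (without conjugation). Realignment: for a matrix $Y$, $\mathrm{vec}(Y)$ is the column vector obtained by stacking the columns of $Y$. For an $m\times m$ block matrix $Z=(Z_{pq})$ with blocks of size $n\times n$, $R(Z)=[\mathrm{vec}(Z_{11}),\dots,\mathrm{vec}(Z_{m1}),\dots,\mathrm{vec}(Z_{1m}),\dots,\mathrm{vec}(Z_{mm})]^{\mathrm t}$, an $m^2\times n^2$ matrix. Bipartite partition: rows and columns of $Q_i$ are indexed by multi-indices $(k_l)_{l\neq i}$, $1\le k_l\le d_l$, listed in the same order as the columns of $X_{(i)}$ (so that $M_N\otimes\cdots\otimes M_{i+1}\otimes M_{i-1}\otimes\cdots\otimes M_1$ is such a matrix with $M_l$ acting on the index $k_l$). For $j\ne i$, $(Q_i)_{j|\widehat j}$ is $Q_i$ regarded as a $d_j\times d_j$ block matrix whose $(p,q)$ block consists of the entries with row index $k_j=p$ and column index $k_j=q$, the rows and columns inside the block being indexed by the remaining indices $(k_l)_{l\neq i,j}$ in a fixed common order.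
   Formalization: The matrix conditions are required of the coefficient tensor of some unit vector equal to |ψ⟩ up to one global phase, common to all i, instead of |ψ⟩ itself: with determinant-one matrices the literal claim fails, e.g. for a two-qubit Bell state φ and ψ = iφ. *)

(* Defs.v *)
From HB Require Import structures.
From mathcomp Require Import all_boot all_order all_algebra.
From mathcomp Require Import reals complex.

Set Implicit Arguments.
Unset Strict Implicit.
Unset Printing Implicit Defensive.

Import Order.TTheory GRing.Theory Num.Theory.

Local Open Scope ring_scope.

(* All indices are 0-based: modes are 'I_N and basis vectors of the mode t are
   'I_(d t). A vector of the tensor product is given by its coefficients in the
   product basis. *)
Definition mindex (N : nat) (d : 'I_N -> nat) : predArgType :=
  {dffun forall t : 'I_N, 'I_(d t)}.

Definition tensor (C : Type) (N : nat) (d : 'I_N -> nat) := {ffun mindex d -> C}.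

Definition pure_state (C : numClosedFieldType) (N : nat) (d : 'I_N -> nat)
    (x : tensor C d) : Prop :=
  \sum_(k : mindex d) `|x k| ^+ 2 = 1.

(* The action of V_1 (x) ... (x) V_N in the product basis. *)
Definition local_op (C : numClosedFieldType) (N : nat) (d : 'I_N -> nat)
    (V : forall t, 'M[C]_(d t)) (x : tensor C d) : tensor C d :=
  [ffun j : mindex d =>
     \sum_(k : mindex d) (\prod_(t < N) V t (j t) (k t)) * x k].

Definition LU_equiv (C : numClosedFieldType) (N : nat) (d : 'I_N -> nat)
    (phi psi : tensor C d) : Prop :=
  exists2 V : forall t, 'M[C]_(d t),
    forall t, V t \is unitarymx & phi = local_op V psi.

(* Unit vectors that differ by a global phase represent the same state. The
   unitaries of LU_equiv absorb such a phase, those of determinant one do not: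
   a phase changes the determinant of a square matricization. *)
Definition same_state (C : numClosedFieldType) (N : nat) (d : 'I_N -> nat)
    (x y : tensor C d) : Prop :=
  exists2 c : C, `|c| = 1 & forall k, x k = c * y k.

Definition in_SU (C : numClosedFieldType) (n : nat) (A : 'M[C]_n) : Prop :=
  A \is unitarymx /\ \det A = 1.

(* Mixed-radix numbering of the multi-indices (k_l)_{l in S} by
   0, ..., dimS d S - 1, the first mode of S varying fastest. *)
Definition dimS (N : nat) (d : 'I_N -> nat) (S : {set 'I_N}) : nat :=
  (\prod_(l in S) d l)%N.

Definition stride (N : nat) (d : 'I_N -> nat) (S : {set 'I_N}) (n : nat) : nat :=
  (\prod_(m in S | m < n) d m)%N.

Definition rank_of (N : nat) (d : 'I_N -> nat) (S : {set 'I_N})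
    (v : 'I_N -> nat) : nat :=
  (\sum_(l in S) v l * stride d S l)%N.

Definition digit (N : nat) (d : 'I_N -> nat) (S : {set 'I_N})
    (b : nat) (l : 'I_N) : nat :=
  ((b %/ stride d S l) %% d l)%N.

Section MixedRadix.

Variables (N : nat) (d : 'I_N -> nat).
Implicit Types (S : {set 'I_N}) (l : 'I_N) (v : 'I_N -> nat).

Lemma prefix_pred S l (m : 'I_N) :
  [&& m \in S, (m < l.+1)%N & m != l] = (m \in S) && (m < l)%N.
Proof.
by rewrite ltnS [(m < l)%N]ltn_neqAle -val_eqE /= [_ && (m <= l)%N]andbC.
Qed.

Lemma strideS S l :
  stride d S l.+1 = ((if l \in S then d l else 1) * stride d S l)%N.
Proof.
rewrite /stride; case: ifPn => lS.
  rewrite (bigD1 l) ?lS ?ltnSn //=; congr (_ * _)%N; apply: eq_bigl => m.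
  by rewrite -andbA prefix_pred.
rewrite mul1n; apply: eq_bigl => m; rewrite ltnS leq_eqVlt.
by case: eqP => // /val_inj ->; rewrite (negPf lS).
Qed.

Lemma strideN S : stride d S N = dimS d S.
Proof. by apply: eq_bigl => m; rewrite ltn_ord andbT. Qed.

Lemma stride_dvd S m n : (m <= n)%N -> (n <= N)%N ->
  (stride d S m %| stride d S n)%N.
Proof.
move=> /subnK <-; elim: (n - m)%N => // k IHk lt_kN.
apply: dvdn_trans (IHk (ltnW lt_kN)) _.
by rewrite addSn (strideS S (Ordinal lt_kN)) dvdn_mull.
Qed.

Lemma rank_of_prefix S v (n : nat) : (n <= N)%N ->
  (forall l, l \in S -> v l < d l)%N ->
  (\sum_(l in S | l < n) v l * stride d S l < stride d S n)%N.
Proof.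
move=> + v_lt; elim: n => [|n IHn] ltnN.
  by rewrite /stride !big_pred0 // => l; rewrite andbF.
have {}IHn := IHn (ltnW ltnN); pose l := Ordinal ltnN.
rewrite (strideS S l) /=; case: ifPn => lS.
  rewrite (bigD1 l) ?lS ?ltnSn //=.
  rewrite (eq_bigl (fun m : 'I_N => (m \in S) && (m < n)%N)); last first.
    by move=> m; rewrite -andbA (prefix_pred S l).
  rewrite -addnS; apply: leq_trans (leq_add (leqnn _) IHn) _.
  by rewrite addnC -mulSn leq_mul2r v_lt // orbT.
rewrite mul1n (eq_bigl (fun m : 'I_N => (m \in S) && (m < n)%N)) // => m.
rewrite ltnS [(m <= n)%N]leq_eqVlt.
by case: eqP => //= mn; rewrite (_ : m = l) ?(negPf lS) //; apply: val_inj.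
Qed.

Lemma rank_of_lt S v :
  (forall l, l \in S -> v l < d l)%N -> (rank_of d S v < dimS d S)%N.
Proof.
move=> /(rank_of_prefix (leqnn N)); rewrite strideN.
by rewrite (eq_bigl (mem S)) // => l; rewrite ltn_ord andbT.
Qed.

Lemma dim_gt0 S (b : 'I_(dimS d S)) l : l \in S -> (0 < d l)%N.
Proof.
move=> lS; have: (0 < dimS d S)%N := leq_ltn_trans (leq0n b) (ltn_ord b).
by rewrite /dimS (bigD1 l) //= muln_gt0 => /andP[].
Qed.

Lemma digit_lt S (b : 'I_(dimS d S)) l : l \in S -> (digit d S b l < d l)%N.
Proof. by move=> lS; rewrite ltn_pmod // (dim_gt0 b). Qed.

Lemma rank_ofK S v l : (forall m, m \in S -> v m < d m)%N -> l \in S ->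
  digit d S (rank_of d S v) l = v l.
Proof.
move=> v_lt lS; have st_gt0 : (0 < stride d S l)%N.
  exact: leq_ltn_trans (leq0n _) (rank_of_prefix (ltnW (ltn_ord l)) v_lt).
rewrite /digit /rank_of (bigID (fun m : 'I_N => m <= l)%N) /=.
have /dvdnP[q ->] : (stride d S l.+1 %|
    \sum_(m in S | ~~ (m <= l)) v m * stride d S m)%N.
  apply: dvdn_sum => m /andP[_]; rewrite -ltnNge => lt_lm.
  by rewrite dvdn_mull // stride_dvd // ltnW.
rewrite strideS lS (bigD1 l) ?lS ?leqnn //=.
rewrite (eq_bigl (fun m : 'I_N => (m \in S) && (m < l)%N)); last first.
  by move=> m; rewrite -andbA -ltnS prefix_pred.
rewrite mulnA addnC addnA -mulnDl divnMDl // divn_small; last first.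
  exact: rank_of_prefix (ltnW (ltn_ord l)) v_lt.
by rewrite addn0 modnMDl modn_small ?v_lt.
Qed.

Definition mirank S (k : mindex d) : 'I_(dimS d S) :=
  Ordinal (@rank_of_lt S (fun l => k l) (fun l _ => ltn_ord (k l))).

Lemma joinmi_subproof (n : 'I_N) (a : 'I_(d n)) (b : 'I_(dimS d [set~ n])) l :
  ((if l == n then a : nat else digit d [set~ n] b l) < d l)%N.
Proof.
by case: eqP => [->//|/eqP ln]; apply: digit_lt; rewrite !inE.
Qed.

(* The multi-index with index a in the mode n, the others being numbered b. *)
Definition joinmi (n : 'I_N) (a : 'I_(d n)) (b : 'I_(dimS d [set~ n])) :
    mindex d :=
  [ffun l : 'I_N => Ordinal (joinmi_subproof a b l)].

Lemma insertmi_subproof S (j : 'I_N) (p : 'I_(d j)) (r : 'I_(dimS d (S :\ j))) :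
  (rank_of d S (fun l => if l == j then p : nat else digit d (S :\ j) r l)
     < dimS d S)%N.
Proof.
apply: rank_of_lt => l lS; case: eqP => [->//|/eqP lj].
by apply: digit_lt; rewrite !inE lj.
Qed.

(* The number of the multi-index over S with index p in the mode j, the others
   being numbered r. *)
Definition insertmi S (j : 'I_N) (p : 'I_(d j)) (r : 'I_(dimS d (S :\ j))) :
    'I_(dimS d S) :=
  Ordinal (insertmi_subproof p r).

Lemma joinmiE (n : 'I_N) (k : mindex d) : joinmi (k n) (mirank [set~ n] k) = k.
Proof.
apply/ffunP => l; rewrite ffunE; apply: val_inj => /=.
by case: eqP => [->//|/eqP ln]; rewrite rank_ofK // !inE.
Qed.

Lemma insertmiE S (j : 'I_N) (k : mindex d) :
  insertmi (k j) (mirank (S :\ j) k) = mirank S k.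
Proof.
apply: val_inj; rewrite /= /rank_of; apply: eq_bigr => l lS.
by case: eqP => [->//|/eqP lj]; rewrite rank_ofK // !inE lj.
Qed.

End MixedRadix.

(* For d n > 0 the number of columns dimS d [set~ n] is d / d_n. *)
Definition matricize (C : Type) (N : nat) (d : 'I_N -> nat) (x : tensor C d)
    (n : 'I_N) : 'M[C]_(d n, dimS d [set~ n]) :=
  \matrix_(a, b) x (joinmi a b).

Lemma matricizeE (C : Type) (N : nat) (d : 'I_N -> nat) (x : tensor C d)
    (n : 'I_N) (k : mindex d) :
  matricize x n (k n) (mirank [set~ n] k) = x k.
Proof. by rewrite mxE joinmiE. Qed.

(* Q_{j|^j} as a d_j x d_j matrix of blocks, for Q with rows and columns
   indexed by the multi-indices over S. *)
Definition blocks (C : Type) (N : nat) (d : 'I_N -> nat) (S : {set 'I_N})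
    (Q : 'M[C]_(dimS d S)) (j : 'I_N) : 'M['M[C]_(dimS d (S :\ j))]_(d j) :=
  \matrix_(p, q) \matrix_(r, s) Q (insertmi p r) (insertmi q s).

Lemma blocksE (C : Type) (N : nat) (d : 'I_N -> nat) (S : {set 'I_N})
    (Q : 'M[C]_(dimS d S)) (j : 'I_N) (k k' : mindex d) :
  blocks Q j (k j) (k' j) (mirank (S :\ j) k) (mirank (S :\ j) k') =
  Q (mirank S k) (mirank S k').
Proof. by rewrite !mxE !insertmiE. Qed.

(* mxvec is row-major, so vec(Y)^t = mxvec Y^T; and the entries of mxvec Z^T
   are Z_11, ..., Z_m1, ..., Z_1m, ..., Z_mm. *)
Definition realign (C : Type) (m n : nat) (Z : 'M['M[C]_n]_m) :
    'M[C]_(m * m, n * n) :=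
  \matrix_(k < m * m) mxvec (mxvec Z^T 0 k)^T.

Lemma realignE (C : Type) (m n : nat) (Z : 'M['M[C]_n]_m) p q r s :
  realign Z (mxvec_index q p) (mxvec_index s r) = Z p q r s.
Proof. by rewrite mxE !mxvecE !mxE. Qed.

(* Main.v *)
(* Matricization turns the local operator of V_1, ..., V_N into
   X_(i) |-> V_i X_(i) (kron V)^t, where kron V is the Kronecker product of the
   V_l, l != i. Rescaling each V_l by a phase makes every determinant 1, at the
   cost of a global phase; the realignments of a nonzero Kronecker product are
   outer products, of rank one. Conversely, for a single mode i, the rank-one
   conditions force Q_i to be a Kronecker product, and its factors can be
   taken unitary because Q_i is. *)
Require Import Defs.
From HB Require Import structures.
From mathcomp Require Import all_boot all_order all_algebra.
From mathcomp Require Import reals complex.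

Set Implicit Arguments.
Unset Strict Implicit.
Unset Printing Implicit Defensive.

Import Order.TTheory GRing.Theory Num.Theory.

Local Open Scope ring_scope.
Local Open Scope sesquilinear_scope.

(** * Mixed-radix digits and changes of summation index *)

Section MultiIndices.

Variables (N : nat) (d : 'I_N -> nat) (d_gt0 : forall l, (0 < d l)%N).
Implicit Types (S T : {set 'I_N}) (k x : mindex d).

(** By induction on [n]: a mode in [S] contributes the quotient of a Euclidean division by the
    current stride, and a mode outside [S] leaves the stride unchanged. *)
Lemma rank_of_digit_prefix S b n : (n <= N)%N ->
  (\sum_(l in S | l < n) digit d S b l * stride d S l = b %% stride d S n)%N.
Proof.
elim: n => [_|n IHn lt_nN].
  by rewrite /stride !big_pred0 ?modn1 // => l; rewrite andbF.
have {}IHn := IHn (ltnW lt_nN); pose l := Ordinal lt_nN.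
rewrite (strideS d S l) /=; case: ifPn => lS.
  rewrite (bigD1 l) ?lS ?ltnSn //=.
  rewrite (eq_bigl (fun m : 'I_N => (m \in S) && (m < n)%N)); last first.
    by move=> m; rewrite -andbA (prefix_pred S l).
  rewrite IHn /digit modn_divl /=.
  rewrite -(modn_dvdm b (dvdn_mull (d l) (dvdnn (stride d S n)))).
  by rewrite -divn_eq.
rewrite mul1n -IHn; apply: eq_bigl => m; rewrite ltnS [(m <= n)%N]leq_eqVlt.
by case: eqP => //= mn; rewrite (_ : m = l) ?(negPf lS) //; apply: val_inj.
Qed.

(** Reducing modulo the positive [d l] gives a full multi-index, with junk entries at modes outside
    [S], so that [mirank] applies to it. *)
Definition digits S (b : nat) : mindex d :=
  [ffun l : 'I_N => Ordinal (ltn_pmod (b %/ stride d S l) (d_gt0 l))].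

Lemma digitsE S b l : digits S b l = digit d S b l :> nat.
Proof. by rewrite ffunE. Qed.

Lemma rank_of_digits S (b : 'I_(dimS d S)) :
  rank_of d S (digit d S b) = b.
Proof.
rewrite /rank_of.
have := rank_of_digit_prefix S b (leqnn N); rewrite strideN modn_small //.
by move=> E; rewrite -[RHS]E; apply: eq_bigl => l; rewrite ltn_ord andbT.
Qed.

Lemma mirankK S k l : l \in S -> digits S (mirank S k) l = k l.
Proof. by move=> lS; apply: val_inj; rewrite /= digitsE rank_ofK. Qed.

Lemma eq_mirank S k x : (forall l, l \in S -> k l = x l) ->
  mirank S k = mirank S x.
Proof.
by move=> kx; apply: val_inj; apply: eq_bigr => l lS; rewrite kx.
Qed.

Lemma digitsK S (b : 'I_(dimS d S)) : mirank S (digits S b) = b.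
Proof.
apply: val_inj; rewrite -[RHS]rank_of_digits.
by apply: eq_bigr => l lS; rewrite digitsE.
Qed.

Lemma eq_digits S (b c : 'I_(dimS d S)) :
  (forall l, l \in S -> digits S b l = digits S c l) -> b = c.
Proof. by move=> bc; rewrite -(digitsK b) -(digitsK c); exact: eq_mirank. Qed.

Lemma digits_insert S j (p : 'I_(d j)) (r : 'I_(dimS d (S :\ j))) :
  j \in S -> digits S (insertmi p r) j = p.
Proof.
move=> jS; apply: val_inj; rewrite /= digitsE rank_ofK ?eqxx // => l lS.
by case: eqP => [->//|/eqP lj]; apply: digit_lt; rewrite !inE lj.
Qed.

Lemma digits_insert_neq S j (p : 'I_(d j)) (r : 'I_(dimS d (S :\ j))) l :
  l \in S -> l != j -> digits S (insertmi p r) l = digits (S :\ j) r l.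
Proof.
move=> lS lj; apply: val_inj; rewrite /= !digitsE.
rewrite rank_ofK ?(negPf lj) // => m mS.
by case: eqP => [->//|/eqP mj]; apply: digit_lt; rewrite !inE mj.
Qed.

(** Stated for any commutative monoid: it serves for sums and for the product giving a
    determinant. *)
Lemma reindex_insert (A : Type) (op0 : A) (op : Monoid.com_law op0) S j
    (F : 'I_(dimS d S) -> A) : j \in S ->
  \big[op/op0]_b F b =
  \big[op/op0]_(p : 'I_(d j)) \big[op/op0]_(r : 'I_(dimS d (S :\ j)))
     F (insertmi p r).
Proof.
move=> jS; rewrite pair_big /=.
rewrite (reindex (fun u : 'I_(d j) * 'I_(dimS d (S :\ j)) =>
  insertmi u.1 u.2)) //=.
apply: onW_bij; exists (fun b : 'I_(dimS d S) =>
  (digits S b j, mirank (S :\ j) (digits S b))).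
  case=> p r /=; rewrite digits_insert //; congr pair.
  rewrite -[RHS]digitsK; apply: eq_mirank => l.
  by rewrite !inE => /andP[lj lS]; rewrite digits_insert_neq.
by move=> b /=; rewrite insertmiE digitsK.
Qed.

Lemma joinmi_n n (a : 'I_(d n)) (b : 'I_(dimS d [set~ n])) : joinmi a b n = a.
Proof. by apply: val_inj; rewrite ffunE /= eqxx. Qed.

Lemma joinmi_neq n (a : 'I_(d n)) (b : 'I_(dimS d [set~ n])) l :
  l != n -> joinmi a b l = digits [set~ n] b l.
Proof.
by move=> ln; apply: val_inj; rewrite ffunE /= digitsE /= (negPf ln).
Qed.

Lemma reindex_joinmi (A : Type) (op0 : A) (op : Monoid.com_law op0) n
    (F : mindex d -> A) :
  \big[op/op0]_k F k =
  \big[op/op0]_(a : 'I_(d n)) \big[op/op0]_(b : 'I_(dimS d [set~ n]))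
     F (joinmi a b).
Proof.
rewrite pair_big /=.
rewrite (reindex (fun u : 'I_(d n) * 'I_(dimS d [set~ n]) =>
  joinmi u.1 u.2)) //=.
apply: onW_bij; exists (fun k => (k n, mirank [set~ n] k)).
  case=> a b /=; rewrite joinmi_n; congr pair.
  rewrite -[RHS]digitsK; apply: eq_mirank => l.
  by rewrite !inE => ln; rewrite joinmi_neq.
by move=> k /=; rewrite joinmiE.
Qed.

(** A generalized distributive law in which an index below [dimS d S] encodes the choice of one [a]
    per mode of [S]. *)
Lemma big_digits_distr (C : comNzRingType) S (F : forall l, 'I_(d l) -> C) :
  \sum_(b < dimS d S) \prod_(l in S) F l (digits S b l) =
  \prod_(l in S) \sum_a F l a.
Proof.
have [n] := ubnP #|S|; elim: n S => // n IHn S; rewrite ltnS => leSn.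
have [->|[j jS]] := set_0Vmem S.
  rewrite big_set0 (eq_bigr (fun=> 1)) => [|b _]; last by rewrite big_set0.
  by rewrite sumr_const card_ord /dimS big_set0.
rewrite (big_setD1 j) //= (reindex_insert _ _ jS) mulr_suml.
rewrite -IHn; last by rewrite (cardsD1 j) jS in leSn.
apply: eq_bigr => p _; rewrite mulr_sumr; apply: eq_bigr => r _.
rewrite (big_setD1 j) //= digits_insert //; congr (_ * _).
by apply: eq_bigr => l; rewrite !inE => /andP[lj lS]; rewrite digits_insert_neq.
Qed.

End MultiIndices.

(** A matrix of rank one is a column times a row, so both sides multiply the same four scalars. *)
Lemma rank1_minor (F : fieldType) m n (A : 'M[F]_(m, n)) a a' b b' :
  \rank A = 1%N ->
  A a b * A a' b' = A a' b * A a b'.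
Proof.
move: (col_base A) (row_base A) (mulmx_base A) => L R AE rA.
rewrite -AE; move: L R {AE}; rewrite rA => L R.
by rewrite !mxE !big_ord1 mulrACA [RHS]mulrACA [L a' _ * _]mulrC.
Qed.

(** * Kronecker products over a set of modes *)

Section Kronecker.

Variables (C : numClosedFieldType) (N : nat) (d : 'I_N -> nat).
Variable d_gt0 : forall l, (0 < d l)%N.
Implicit Types (S T : {set 'I_N}) (k x y : mindex d) (z : tensor C d).
Implicit Types (A B M V W : forall l, 'M[C]_(d l)).

Local Notation digits := (digits d_gt0).

Lemma dimS_gt0 S : (0 < dimS d S)%N.
Proof. exact: prodn_cond_gt0. Qed.

(** Entries are given through digits instead of iterating a binary product: no casts arise, and any
    mode can be split off first. *)
Definition kron S M : 'M[C]_(dimS d S) :=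
  \matrix_(b, c) \prod_(l in S) M l (digits S b l) (digits S c l).

Lemma kron_mirank S M k x :
  kron S M (mirank S k) (mirank S x) = \prod_(l in S) M l (k l) (x l).
Proof. by rewrite mxE; apply: eq_bigr => l lS; rewrite !mirankK. Qed.

Lemma kronM S A B : kron S (fun l => A l *m B l) = kron S A *m kron S B.
Proof.
apply/matrixP => b c; rewrite !mxE.
under [LHS]eq_bigr => l _ do rewrite mxE.
rewrite -(big_digits_distr d_gt0 S
  (fun l a => A l (digits S b l) a * B l a (digits S c l))).
by apply: eq_bigr => e _; rewrite !mxE -big_split.
Qed.

Lemma eq_kron S A B : (forall l, l \in S -> A l = B l) -> kron S A = kron S B.
Proof.
by move=> AB; apply/matrixP => b c; rewrite !mxE; apply: eq_bigr => l /AB ->.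
Qed.

Lemma kron_diag S (D : forall l, 'rV[C]_(d l)) :
  kron S (fun l => diag_mx (D l)) =
  diag_mx (\row_b \prod_(l in S) D l 0 (digits S b l)).
Proof.
apply/matrixP => b c; rewrite !mxE; have [<-|bc] := eqVneq b c.
  by rewrite mulr1n; apply: eq_bigr => l _; rewrite mxE eqxx mulr1n.
rewrite mulr0n.
(* Distinct indices differ in some digit, and the factor of that mode vanishes. *)
have [/forall_inP bcE|] :=
  boolP [forall (l | l \in S), digits S b l == digits S c l].
  by case/eqP: bc; apply: (@eq_digits _ _ d_gt0) => l /bcE /eqP.
rewrite negb_forall_in => /exists_inP[l lS bcl].
by rewrite (bigD1 l) //= mxE (negPf bcl) mul0r.
Qed.

Lemma kron1 S : kron S (fun l => 1%:M) = 1%:M.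
Proof.
rewrite -[RHS]diag_const_mx (eq_kron (fun l _ => esym (diag_const_mx _ _))).
rewrite kron_diag; congr diag_mx; apply/rowP => b; rewrite !mxE.
by apply: big1 => l _; rewrite mxE.
Qed.

Lemma kron_trC S M : (kron S M)^t* = kron S (fun l => (M l)^t*).
Proof.
apply/matrixP => b c; rewrite !mxE rmorph_prod /=.
by apply: eq_bigr => l _; rewrite !mxE.
Qed.

Lemma kron_unitary S M : (forall l, l \in S -> M l \is unitarymx) ->
  kron S M \is unitarymx.
Proof.
move=> Mu; apply/unitarymxP; rewrite kron_trC -kronM -[RHS](kron1 S).
by apply: eq_kron => l lS; exact/unitarymxP/Mu.
Qed.

(* Diagonalizing each factor reduces the determinant to that of a Kronecker
   product of diagonal matrices. *)
Lemma det_kron_SU S M : (forall l, in_SU (M l)) -> \det (kron S M) = 1.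
Proof.
move=> Msu; pose P l := spectralmx (M l).
pose D l := spectral_diag (M l).
have Pu l : P l \is unitarymx by exact: spectral_unitarymx.
have ME l : M l = (P l)^t* *m (diag_mx (D l) *m P l).
  rewrite mulmxA -invmx_unitary //; apply/orthomx_spectralP.
  have [Mu _] := Msu l; apply/normalmxP.
  by rewrite (unitarymxP Mu) (mulmx1C (unitarymxP Mu)).
have detD l : \prod_a D l 0 a = 1.
  have [_ detM] := Msu l; rewrite -[RHS]detM ME mulmxA.
  rewrite det_mulmx det_mulmx mulrAC.
  by rewrite -det_mulmx (mulmx1C (unitarymxP (Pu l))) det1 mul1r det_diag.
rewrite (eq_kron (fun l _ => ME l)) kronM kronM !det_mulmx mulrC -mulrA.
rewrite -det_mulmx -kronM (eq_kron (fun l _ => unitarymxP (Pu l))) kron1 det1.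
rewrite mulr1.
rewrite kron_diag det_diag; under eq_bigr => b _ do rewrite mxE.
(* With the products exchanged, each [D l 0 p] occurs [dimS d (S :\ l)] times, so mode [l]
   contributes a power of [\det (M l)], which is 1. *)
rewrite exchange_big /= big1 // => l lS; rewrite (reindex_insert d_gt0 _ _ lS).
under eq_bigr => p _ do under eq_bigr => r _ do rewrite digits_insert //.
under eq_bigr => p _ do rewrite prodr_const card_ord.
by rewrite prodrXl detD expr1n.
Qed.

(** * Rank-one realignments and Kronecker factorization *)

Lemma rank_realign_kron S M j : j \in S -> kron S M != 0 ->
  \rank (realign (blocks (kron S M) j)) = 1%N.
Proof.
move=> jS nz; pose u : 'rV[C]_(d j * d j) := mxvec (M j)^T.
pose v := mxvec (kron (S :\ j) M)^T.
have E : realign (blocks (kron S M) j) = u^T *m v.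
  apply/matrixP => a b; case/mxvec_indexP: a => q p.
  case/mxvec_indexP: b => s r.
  rewrite realignE !mxE big_ord1 !mxE !mxvecE !mxE (big_setD1 j) //=.
  rewrite !digits_insert //; congr (_ * _); apply: eq_bigr => l.
  by rewrite !inE => /andP[lj lS]; rewrite !digits_insert_neq.
apply/eqP; rewrite eqn_leq; apply/andP; split.
  by rewrite E (leq_trans (mxrankM_maxl _ _)) // rank_leq_col.
(* Realignment only permutes entries, so it vanishes only if the matrix does. *)
rewrite lt0n mxrank_eq0; apply: contraNneq nz => Z.
apply/eqP/matrixP => b c; rewrite -(digitsK d_gt0 b) -(digitsK d_gt0 c).
by rewrite -(blocksE _ j) -realignE Z !mxE.
Qed.

(** A 2 x 2 minor of the realignment vanishes, which lets two entries of [Q] exchange their mode-[j]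
    indices. Pointwise equations leave open how the four new multi-indices are built. *)
Lemma realign_minor S (Q : 'M[C]_(dimS d S)) (j : 'I_N) k k' x x'
    (u u' v v' : mindex d) :
  (forall l, u l = if l == j then x l else k l) ->
  (forall l, u' l = if l == j then x' l else k' l) ->
  (forall l, v l = if l == j then k l else x l) ->
  (forall l, v' l = if l == j then k' l else x' l) ->
  \rank (realign (blocks Q j)) = 1%N ->
  Q (mirank S k) (mirank S k') * Q (mirank S x) (mirank S x') =
  Q (mirank S u) (mirank S u') * Q (mirank S v) (mirank S v').
Proof.
move=> uE u'E vE v'E rk1.
have QE k1 k2 : Q (mirank S k1) (mirank S k2) =
    realign (blocks Q j) (mxvec_index (k2 j) (k1 j))
      (mxvec_index (mirank (S :\ j) k2) (mirank (S :\ j) k1)).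
  by rewrite realignE blocksE.
have off (k1 k2 k3 : mindex d) :
    (forall l, k1 l = if l == j then k2 l else k3 l) ->
    mirank (S :\ j) k1 = mirank (S :\ j) k3.
  by move=> k1E; apply: eq_mirank => l; rewrite !inE k1E => /andP[/negPf->].
rewrite !QE (off _ _ _ uE) (off _ _ _ u'E) (off _ _ _ vE) (off _ _ _ v'E).
by rewrite uE u'E vE v'E !eqxx; exact: rank1_minor.
Qed.

(* All 2 x 2 minors of a rank-one realignment vanish, so the index of the mode j
   can be moved from an arbitrary entry of Q to a fixed nonzero entry; doing so
   for one mode after the other splits off the Kronecker factors. *)
Lemma kron_factorization S (Q : 'M[C]_(dimS d S)) : Q != 0 ->
  (forall j, j \in S -> \rank (realign (blocks Q j)) = 1%N) ->
  exists c M, Q = c *: kron S M.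
Proof.
move=> /matrix0Pn[b0 [c0 nz]] Qrk; pose x := digits S b0; pose y := digits S c0.
pose f k k' := Q (mirank S k) (mirank S k').
have fxy : f x y != 0 by rewrite /f !digitsK.
(* The entries of [Q] where only mode [j] leaves the base entry [f x y], normalized to be 1
   there. *)
pose M j : 'M[C]_(d j) :=
  \matrix_(a, a')
    (f [ffun l => dfwith x a l] [ffun l => dfwith y a' l] / f x y).
pose mix T k k' : mindex d := [ffun l => if l \in T then k' l else k l].
have mixl T k k' l : mix T k k' l = if l \in T then k' l else k l.
  exact: ffunE.
have swap j k k' : j \in S -> f k k' = f (mix [set j] k x) (mix [set j] k' y)
    * M j (k j) (k' j).
  move=> jS; rewrite mxE mulrA; apply: (canRL (mulfK fxy)); rewrite /f.
  apply: realign_minor (Qrk j jS) => l; rewrite ?mixl ?inE //.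
    rewrite ffunE; case: dfwithP => [|m]; rewrite ?eqxx // eq_sym.
    by move=> /negPf->.
  rewrite ffunE; case: dfwithP => [|m]; rewrite ?eqxx // eq_sym.
  by move=> /negPf->.
have mixE T k k' : T \subset S -> f k k' = f (mix T k x) (mix T k' y)
    * \prod_(j in T) M j (k j) (k' j).
  have [n] := ubnP #|T|; elim: n T => // n IHn T; rewrite ltnS => leTn TS.
  have [->|[j jT]] := set_0Vmem T.
    have mix0 k1 k2 : mix set0 k1 k2 = k1.
      by apply/ffunP => l; rewrite mixl inE.
    by rewrite big_set0 mulr1 !mix0.
  rewrite (IHn (T :\ j)); last 2 first.
  - by rewrite (cardsD1 j) jT in leTn.
  - exact: subset_trans (subD1set _ _) TS.
  rewrite (swap j) ?(subsetP TS) // (big_setD1 j jT) /= -mulrA.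
  have mixj k1 k2 : mix [set j] (mix (T :\ j) k1 k2) k2 = mix T k1 k2.
    apply/ffunP => l; rewrite !mixl !inE; case: eqP => [->|//].
    by rewrite jT.
  by rewrite !mixj !mixl !inE eqxx.
exists (f x y), M; apply/matrixP => b c.
rewrite mxE -(digitsK d_gt0 b) -(digitsK d_gt0 c) kron_mirank.
rewrite -[LHS]/(f _ _) (mixE S) //; congr (_ * _).
(* The reset indices agree with the base ones on [S], which is all that [mirank] reads. *)
by congr (Q _ _); apply: eq_mirank => l lS; rewrite mixl lS.
Qed.

Lemma unitarymxZ m n (c : C) (A : 'M[C]_(m, n)) :
  `|c| = 1 -> A \is unitarymx -> c *: A \is unitarymx.
Proof.
move=> c1 /unitarymxP AA; apply/unitarymxP.
rewrite linearZ /= map_mxZ -scalemxAl -scalemxAr scalerA AA.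
by rewrite -normCK c1 expr1n scale1r.
Qed.

Lemma kronZ S (c : 'I_N -> C) M :
  kron S (fun l => c l *: M l) = (\prod_(l in S) c l) *: kron S M.
Proof.
apply/matrixP => b b'; rewrite !mxE -big_split.
by apply: eq_bigr => l _; rewrite !mxE.
Qed.

(* Unitarity of c *: kron S M forces each M l *m (M l)^t* to be a positive
   scalar matrix, and the factors are normalized by its square root. *)
Lemma unitary_kron_factorization S (Q : 'M[C]_(dimS d S)) :
  Q \is unitarymx ->
  (forall j, j \in S -> \rank (realign (blocks Q j)) = 1%N) ->
  exists c V, [/\ `|c| = 1, forall l, l \in S -> V l \is unitarymx
                & Q = c *: kron S V].
Proof.
move=> Qu Qrk; have Qnz : Q != 0.
  apply: contraTneq (dimS_gt0 S) => Q0.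
  by rewrite -(mxrank_unitary Qu) Q0 mxrank0.
have [c [M QE]] := kron_factorization Qnz Qrk.
pose G l := M l *m (M l)^t*.
have Gkron : `|c| ^+ 2 *: kron S G = 1%:M.
  rewrite -(unitarymxP Qu) QE linearZ /= map_mxZ -scalemxAl -scalemxAr scalerA.
  by rewrite normCK kron_trC kronM.
pose x : mindex d := [ffun l : 'I_N => Ordinal (d_gt0 l)].
have Gscal l : l \in S -> exists2 e, 0 < e & G l = e%:M.
  (* [e] gathers the scalar and the diagonal entries of the other factors at [x]; varying only mode
     [l] in [Gkron] shows that [e *: G l] is the identity. *)
  move=> lS; pose e := `|c| ^+ 2 * \prod_(m in S :\ l) G m (x m) (x m).
  have Ge a a' : e * G l a a' = (a == a')%:R.
    pose k : mindex d := [ffun m => dfwith x a m].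
    pose k' : mindex d := [ffun m => dfwith x a' m].
    have kl : k l = a by rewrite ffunE dfwith_in.
    have k'l : k' l = a' by rewrite ffunE dfwith_in.
    have := congr1 (fun A : 'M_(dimS d S) => A (mirank S k) (mirank S k'))
      Gkron.
    rewrite [LHS]mxE kron_mirank [RHS]mxE (big_setD1 l) //= kl k'l mulrCA mulrC.
    rewrite (eq_bigr (fun m => G m (x m) (x m))) => [E|m]; last first.
      rewrite !inE eq_sym => /andP[ml _].
      by congr (G m _ _); rewrite [LHS]ffunE dfwith_out.
    rewrite {}E; congr (nat_of_bool _)%:R.
    apply/eqP/eqP => [kk'|aa']; last by rewrite /k /k' aa'.
    by rewrite -kl -k'l -(mirankK d_gt0 k lS) kk' mirankK.
  have enz : e != 0.
    apply: contra_eq_neq (Ge (x l) (x l)) => ->.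
    by rewrite mul0r eqxx eq_sym oner_neq0.
  have GE a a' : G l a a' = e^-1 *+ (a == a').
    by rewrite -[LHS](mulKf enz) Ge mulr_natr.
  exists e^-1; last by apply/matrixP => a a'; rewrite GE mxE.
  (* Positivity: the scalar is a diagonal entry of [G l], hence a sum of squared moduli. *)
  rewrite lt_def invr_eq0 enz /=.
  have <- : G l (x l) (x l) = e^-1 by rewrite GE eqxx.
  by rewrite mxE; apply: sumr_ge0 => b _; rewrite !mxE mul_conjC_ge0.
pose e l := G l (x l) (x l).
have Gpos l : l \in S -> 0 < e l.
  by case/Gscal => g g0 GE; rewrite /e GE mxE eqxx.
have GE l : l \in S -> G l = (e l)%:M.
  by case/Gscal => g g0 GE; rewrite /e GE mxE eqxx.
pose V l := (sqrtC (e l))^-1 *: M l.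
have Vu l : l \in S -> V l \is unitarymx.
  move=> lS; apply/unitarymxP.
  rewrite linearZ /= map_mxZ -scalemxAl -scalemxAr scalerA -normCK.
  rewrite -/(G l) GE // scale_scalar_mx normfV.
  rewrite ger0_norm ?sqrtC_ge0 ?ltW ?Gpos //.
  by rewrite exprVn sqrtCK mulVf // gt_eqF ?Gpos.
pose g := \prod_(l in S) sqrtC (e l).
have gnz : g != 0.
  by apply/prodf_neq0 => l lS; rewrite sqrtC_eq0 gt_eqF ?Gpos.
have QV : Q = (c * g) *: kron S V.
  by rewrite kronZ scalerA -mulrA prodfV mulfV // mulr1 -QE.
exists (c * g), V; split=> //.
have Vuk := kron_unitary Vu.
(* Both [Q] and the normalized Kronecker product are unitary, so the remaining scalar has modulus
   one. *)
have : `|c * g| ^+ 2 *: 1%:M = 1%:M :> 'M[C]_(dimS d S).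
  rewrite -[RHS](unitarymxP Qu) QV linearZ /= map_mxZ -scalemxAl -scalemxAr.
  by rewrite scalerA normCK (unitarymxP Vuk).
move=> /(congr1 (fun A : 'M_(dimS d S) => A (mirank S x) (mirank S x))).
rewrite !mxE eqxx mulr1 => /eqP; by rewrite sqrp_eq1 // => /eqP.
Qed.

(** * Local operators seen through matricizations *)

Lemma matricize_local_op V z n :
  matricize (local_op V z) n =
    V n *m matricize z n *m (kron [set~ n] V)^T.
Proof.
apply/matrixP => a b; rewrite !mxE ffunE (reindex_joinmi d_gt0 _ n).
rewrite exchange_big; apply: eq_bigr => c _; rewrite !mxE mulr_suml.
apply: eq_bigr => e _; rewrite mxE (bigD1 n) //= !joinmi_n mulrAC.
congr (_ * _ * _); apply: eq_big => l; rewrite ?inE // => ln.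
by rewrite !(joinmi_neq d_gt0).
Qed.

Lemma matricize_inj (n : 'I_N) :
  injective (fun z : tensor C d => matricize z n).
Proof.
by move=> z1 z2 E; apply/ffunP => k; rewrite -!(matricizeE _ n) E.
Qed.

(** Matricizing along a single mode is injective, so one such identity already determines the local
    operator, with [U] in mode [n] and [V] elsewhere. *)
Lemma LU_equiv_matricize z1 z2 (n : 'I_N) (U : 'M[C]_(d n)) V :
  U \is unitarymx -> (forall l, l != n -> V l \is unitarymx) ->
  matricize z1 n = U *m matricize z2 n *m (kron [set~ n] V)^T ->
  LU_equiv z1 z2.
Proof.
move=> Uu Vu E.
exists (dfwith V U) => [l|].
  by case: dfwithP => // m nm; rewrite Vu // eq_sym.
apply: (@matricize_inj n); rewrite /= matricize_local_op dfwith_in E.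
congr (_ *m _^T); apply: eq_kron => l; rewrite !inE => ln.
by rewrite dfwith_out // eq_sym.
Qed.

(** The adjoints undo the local operator; this is checked on a matricization, whence the mode
    [n]. *)
Lemma LU_equiv_sym z1 z2 (n : 'I_N) : LU_equiv z1 z2 -> LU_equiv z2 z1.
Proof.
case=> V Vu ->; exists (fun l => (V l)^t*) => [l|].
  by rewrite trmxC_unitary.
have VV l : (V l)^t* *m V l = 1%:M by apply/mulmx1C/unitarymxP.
apply: (@matricize_inj n); rewrite /= !matricize_local_op !mulmxA VV mul1mx.
rewrite -mulmxA -trmx_mul -kronM (eq_kron (fun l _ => VV l)).
by rewrite kron1 trmx1 mulmx1.
Qed.

(** * Normalizing determinants by phases *)

Lemma norm_det_unitary n (A : 'M[C]_n) : A \is unitarymx -> `|\det A| = 1.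
Proof.
move=> /unitarymxP /(congr1 determinant).
rewrite det_mulmx det1 det_map_mx det_tr -normCK => /eqP.
by rewrite sqrp_eq1 // => /eqP.
Qed.

(** Scaling by [c] multiplies the determinant by [c ^+ n], so the inverse of an [n]-th root of it
    works. *)
Lemma unitary_phase_SU n (A : 'M[C]_n) : (0 < n)%N -> A \is unitarymx ->
  exists2 c, `|c| = 1 & in_SU (c *: A).
Proof.
move=> n0 Au; pose c := (n.-root (\det A))^-1.
have c1 : `|c| = 1.
  by rewrite normfV norm_rootC norm_det_unitary // rootC1 // invr1.
exists c => //; split; first exact: unitarymxZ.
rewrite detZ exprVn rootCK // mulVf // -normr_eq0 norm_det_unitary //.
exact: oner_neq0.
Qed.

Lemma local_opZ (c : 'I_N -> C) V z k :
  local_op (fun l => c l *: V l) z k = (\prod_l c l) * local_op V z k.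
Proof.
rewrite !ffunE mulr_sumr; apply: eq_bigr => x _; rewrite mulrA -big_split.
by congr (_ * _); apply: eq_bigr => l _; rewrite mxE.
Qed.

End Kronecker.

(** Without any multi-index the squared norm would be an empty sum, not 1. *)
Lemma pure_state_dim_gt0 (C : numClosedFieldType) (N : nat) (d : 'I_N -> nat)
    (x : tensor C d) : pure_state x -> forall l, (0 < d l)%N.
Proof.
move=> xP l; have [k _|k0] := pickP (predT : pred (mindex d)).
  exact: leq_ltn_trans (leq0n _) (ltn_ord (k l)).
by move: xP (oner_neq0 C); rewrite /pure_state big_pred0 // => <-; rewrite eqxx.
Qed.

Theorem theorem6 (R : realType) (N : nat) (d : 'I_N -> nat)
    (phi psi : tensor R[i] d) :
  (0 < N)%N -> pure_state phi -> pure_state psi ->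
  (LU_equiv phi psi <->
   exists2 psi' : tensor R[i] d, same_state psi' psi &
     forall i : 'I_N,
       exists (U : 'M[R[i]]_(d i)) (Q : 'M[R[i]]_(dimS d [set~ i])),
         [/\ in_SU U,
             in_SU Q,
             matricize psi' i = U *m matricize phi i *m Q^T &
             forall j : 'I_N, j != i -> \rank (realign (blocks Q j)) = 1%N]).
Proof.
move=> N_gt0 phiP _; have d_gt0 := pure_state_dim_gt0 phiP.
pose n := Ordinal N_gt0.
(* [LU_equiv] expresses [phi] through [psi], the matricized identities go the other way; hence the
   symmetry. *)
split=> [/(LU_equiv_sym d_gt0 n)[W Wu ->]|[psi' [c c1 psi'E] Hi]].
  have /fin_all_exists2[c c1 cW] l := unitary_phase_SU (d_gt0 l) (Wu l).
  (* The phases of the modes multiply to a global one, so a representative of the same state is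
     reached. *)
  exists (local_op (fun l => c l *: W l) phi).
    exists (\prod_l c l) => [|k]; last exact: local_opZ.
    by rewrite normr_prod big1.
  move=> i; exists (c i *: W i), (kron d_gt0 [set~ i] (fun l => c l *: W l)).
  have Ku : kron d_gt0 [set~ i] (fun l => c l *: W l) \is unitarymx.
    by apply: kron_unitary => l _; case: (cW l).
  split=> [//||| j ji]; first by split=> //; exact: det_kron_SU.
    exact: matricize_local_op.
  apply: rank_realign_kron; first by rewrite !inE.
  apply: contraTneq (dimS_gt0 d_gt0 [set~ i]) => K0.
  by rewrite -(mxrank_unitary Ku) K0 mxrank0.
have [U [Q [[Uu _] [Qu _] E Qrk]]] := Hi n.
have [|g [V [g1 Vu QE]]] := unitary_kron_factorization d_gt0 Qu.
  by move=> j; rewrite !inE; exact: Qrk.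
apply: (LU_equiv_sym d_gt0 n).
(* Both phases, [c^-1] from the representative and [g] from factoring [Q], are absorbed into mode
   [n]. *)
apply: (LU_equiv_matricize (d_gt0 := d_gt0) (U := (c^-1 * g) *: U) (V := V)).
- by rewrite unitarymxZ // normrM normfV c1 g1 invr1 mulr1.
- by move=> l ln; rewrite Vu // !inE.
have -> : matricize psi n = c^-1 *: matricize psi' n.
  apply/matrixP => a b; rewrite !mxE psi'E mulKf //.
  by rewrite -normr_eq0 c1 oner_neq0.
by rewrite E QE linearZ /= -scalemxAr -!scalemxAl scalerA.
Qed.
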